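(* Over a ring $R$, any right Gabriel filter $\mathcal{F}$ is a divisible right Oka family. Moreover, any right ideal $P\in\operatorname{Max}(\mathcal{F}')$ is comonoform, where $\mathcal{F}'$ is the set of right ideals of $R$ not in $\mathcal{F}$ and $\operatorname{Max}(\mathcal{F}')$ is the set of its elements maximal with respect to inclusion.
   Context: Rings are associative with $1$, modules are unital. For an element $m$ and a submodule $N$ of a right $R$-module $M$, put $m^{-1}N:=\{r\in R: mr\in N\}$; in particular $a^{-1}I=\{r\in R: ar\in I\}$ for a right ideal $I$ and $a\in R$. A right Gabriel filter in $R$ is a nonempty family $\mathcal{F}$ of right ideals of $R$ such that, for right ideals $I,J$ of $R$: (1) if $I\in\mathcal{F}$ and $J\supseteq I$ then $J\in\mathcal{F}$; (2) if $I,J\in\mathcal{F}$ then $I\cap J\in\mathcal{F}$; (3) if $I\in\mathcal{F}$ and $x\in R$ then $x^{-1}I\in\mathcal{F}$; (4) if $I\in\mathcal{F}$ and $J$ is such that $x^{-1}J\in\mathcal{F}$ for all $x\in I$, then $J\in\mathcal{F}$. A right Oka family in $R$ is a family $\mathcal{F}$ of right ideals of $R$ with $R\in\mathcal{F}$ such that for every right ideal $I$ and every $a\in R$: if $I+aR\in\mathcal{F}$ and $a^{-1}I\in\mathcal{F}$, then $I\in\mathcal{F}$. A family $\mathcal{F}$ of right ideals is divisible if for all $a\in R$, $I\in\mathcal{F}$ implies $a^{-1}I\in\mathcal{F}$. A submodule $N\subseteq M$ is dense in $M$ if for all $x,y\in M$ with $x\neq 0$, $x\cdot(y^{-1}N)\neq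 0$. A nonzero right module $M$ is monoform if every nonzero submodule of $M$ is dense in $M$ (equivalently, for every submodule $C\subseteq M$, every nonzero homomorphism $C\to M$ is injective). A right ideal $P\subsetneq R$ is comonoform if the right module $R/P$ is monoform. *)

(* Defs.v *)
From HB Require Import structures.
From mathcomp Require Import all_boot all_algebra.
From mathcomp Require Import boolp classical_sets.

Set Implicit Arguments.
Unset Strict Implicit.
Unset Printing Implicit Defensive.

Import GRing.Theory.
Local Open Scope classical_set_scope.
Local Open Scope ring_scope.
Local Open Scope quotient_scope.

(* Rings are of type [pzRingType], so that the zero ring is allowed.  A right
   R-module is a left module over the converse ring R^c; [ract m r] is the
   right action m . r.  The regular right module R_R is R^c^o. *)
Definition ract (R : pzRingType) (M : lmodType R^c) (m : M) (r : R) : M :=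
  (r : R^c) *: m.

Lemma ractA (R : pzRingType) (M : lmodType R^c) (m : M) (r s : R) :
  ract (ract m r) s = ract m (r * s).
Proof. by rewrite /ract scalerA. Qed.

Lemma ract_regular (R : pzRingType) (a r : R) :
  ract (a : R^c^o) r = a * r.
Proof. by []. Qed.

Record is_right_ideal (R : pzRingType) (I : set R) : Prop := IsRightIdeal {
  right_ideal0 : I 0;
  right_idealD : forall x y, I x -> I y -> I (x + y);
  right_idealM : forall x r, I x -> I (x * r) }.

Record is_submodule (R : pzRingType) (M : lmodType R^c) (N : set M) : Prop :=
  IsSubmodule {
    submodule0 : N 0;
    submoduleD : forall x y, N x -> N y -> N (x + y);
    submoduleZ : forall x (r : R), N x -> N (ract x r) }.

Lemma right_ideal_submodule (R : pzRingType) (I : set R) :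
  is_right_ideal I -> is_submodule (I : set R^c^o).
Proof. by case=> I0 ID IM; split. Qed.

(* m^{-1}N, and its special case a^{-1}I for the regular module. *)
Definition colon (R : pzRingType) (M : lmodType R^c) (m : M) (N : set M) :
  set R := [set r | N (ract m r)].

Definition rcolon (R : pzRingType) (a : R) (I : set R) : set R :=
  [set r | I (a * r)].

Lemma colon_regular (R : pzRingType) (a : R) (I : set R) :
  colon (a : R^c^o) I = rcolon a I.
Proof. by []. Qed.

(* I + aR *)
Definition add_principal (R : pzRingType) (I : set R) (a : R) : set R :=
  [set x | exists i r, I i /\ x = i + a * r].

Record right_Gabriel_filter (R : pzRingType) (F : set (set R)) : Prop :=
  RightGabrielFilter {
    Gabriel_nonempty : F !=set0;
    Gabriel_right_ideal : forall I, F I -> is_right_ideal I;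
    Gabriel_up : forall I J, is_right_ideal I -> is_right_ideal J ->
      F I -> I `<=` J -> F J;
    Gabriel_cap : forall I J, is_right_ideal I -> is_right_ideal J ->
      F I -> F J -> F (I `&` J);
    Gabriel_colon : forall I x, is_right_ideal I -> F I -> F (rcolon x I);
    Gabriel_local : forall I J, is_right_ideal I -> is_right_ideal J ->
      F I -> (forall x, I x -> F (rcolon x J)) -> F J }.

Record right_Oka_family (R : pzRingType) (F : set (set R)) : Prop :=
  RightOkaFamily {
    Oka_right_ideal : forall I, F I -> is_right_ideal I;
    Oka_top : F setT;
    Oka_ext : forall (I : set R) (a : R), is_right_ideal I ->
      F (add_principal I a) -> F (rcolon a I) -> F I }.

Definition divisible (R : pzRingType) (F : set (set R)) : Prop :=
  forall (a : R) (I : set R), F I -> F (rcolon a I).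

Definition family_compl (R : pzRingType) (F : set (set R)) : set (set R) :=
  [set I | is_right_ideal I /\ ~ F I].

Definition Max (R : pzRingType) (G : set (set R)) : set (set R) :=
  [set P | G P /\ forall J, G J -> P `<=` J -> J = P].

Definition dense (R : pzRingType) (M : lmodType R^c) (N : set M) : Prop :=
  forall x y : M, x <> 0 -> (ract x) @` (colon y N) <> [set 0].

Definition monoform (R : pzRingType) (M : lmodType R^c) : Prop :=
  (exists x : M, x <> 0) /\
  forall N : set M, is_submodule N -> N <> [set 0] -> dense N.

(* The quotient right module M/N: the additive group is the quotient of
   [ring_quotient], to which the action of R is added. *)
Section ModuleQuotient.
Variables (R : pzRingType) (M : lmodType R^c) (N : set M).

Definition submod_pred (hN : is_submodule N) : {pred M} :=
  fun x => `[< N x >].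

Variable hN : is_submodule N.

Lemma submod_predP x : reflect (N x) (x \in submod_pred hN).
Proof. exact: asboolP. Qed.

Lemma submod_pred_zmod_closed : zmod_closed (submod_pred hN).
Proof.
split=> [|x y /submod_predP Nx /submod_predP Ny]; apply/submod_predP.
  exact: submodule0.
by apply: submoduleD => //; rewrite -scaleN1r; apply: (submoduleZ hN).
Qed.

HB.instance Definition _ :=
  GRing.isZmodClosed.Build M (submod_pred hN) submod_pred_zmod_closed.

Definition module_quot : Type := Quotient.quot (submod_pred hN).

HB.instance Definition _ := GRing.Zmodule.on module_quot.

Definition module_proj (x : M) : module_quot :=
  \pi_(Quotient.quot (submod_pred hN)) x.

Lemma module_projP x y : module_proj x = module_proj y <-> N (x - y).
Proof.
by split=> [/eqP|/submod_predP]; rewrite /module_proj -?Quotient.idealrBE;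
  [move/submod_predP | rewrite Quotient.idealrBE => /eqP].
Qed.

Lemma module_proj_surj (q : module_quot) : exists x, q = module_proj x.
Proof. by exists (repr q); rewrite /module_proj reprK. Qed.

Lemma module_projD x y : module_proj (x + y) = module_proj x + module_proj y.
Proof. by rewrite /module_proj !piE. Qed.

Definition module_quot_scale (r : R^c) (q : module_quot) : module_quot :=
  module_proj (r *: repr (q : Quotient.quot (submod_pred hN))).

Lemma module_proj_scale r x :
  module_proj (r *: x) = module_quot_scale r (module_proj x).
Proof.
apply/module_projP; rewrite -scalerBr; apply: (submoduleZ hN).
by apply/module_projP; rewrite /module_proj reprK.
Qed.

Fact module_quot_scaleA a b v :
  module_quot_scale a (module_quot_scale b v) = module_quot_scale (a * b) v.
Proof.
by have [x ->] := module_proj_surj v; rewrite -!module_proj_scale scalerA.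
Qed.

Fact module_quot_scale1 : left_id 1 module_quot_scale.
Proof.
by move=> v; have [x ->] := module_proj_surj v;
  rewrite -module_proj_scale scale1r.
Qed.

Fact module_quot_scaleDr : right_distributive module_quot_scale +%R.
Proof.
move=> a u v; have [x ->] := module_proj_surj u.
have [y ->] := module_proj_surj v.
by rewrite -module_projD -!module_proj_scale scalerDr module_projD.
Qed.

Fact module_quot_scaleDl v :
  {morph module_quot_scale^~ v : a b / a + b >-> a + b}.
Proof.
move=> a b; have [x ->] := module_proj_surj v.
by rewrite -!module_proj_scale scalerDl module_projD.
Qed.

HB.instance Definition _ := GRing.Zmodule_isLmodule.Build R^c module_quot
  module_quot_scaleA module_quot_scale1 module_quot_scaleDr
  module_quot_scaleDl.

Lemma module_proj_ract x (r : R) :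
  module_proj (ract x r) = ract (module_proj x) r.
Proof. exact: module_proj_scale. Qed.

End ModuleQuotient.

Definition comonoform (R : pzRingType) (P : set R) : Prop :=
  P <> setT /\
  exists hP : is_right_ideal P,
    monoform (module_quot (right_ideal_submodule hP)).

(* Main.v *)
Require Import Defs.
From mathcomp Require Import all_boot all_algebra.
From mathcomp Require Import boolp classical_sets.

(** Write a^-1 I for [rcolon a I].  The Oka property comes from axiom (4),
    tested on the elements of I + aR: for x = i + a r with i in I, the term i
    does not affect membership of x s in I, so x^-1 I = r^-1 (a^-1 I), which
    lies in F as soon as a^-1 I does ([Gabriel_filter_Oka]).

    Let P be maximal outside F.  Every right ideal strictly above P lies in F
    ([Max_compl_above]); applied to P + aR with a outside P, this and the Oka
    property show that the annihilator a^-1 P of a nonzero element of R/P is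
    never in F ([Max_compl_rcolon]).  A nonzero submodule of R/P is J/P with J
    strictly above P, so J and all b^-1 J are in F.  If J/P were not dense,
    some b^-1 J would lie in some a^-1 P with a outside P, and a^-1 P would
    then be in F, which is impossible. *)

Import GRing.Theory.
Local Open Scope classical_set_scope.
Local Open Scope ring_scope.

Section RightIdeals.
Variable R : pzRingType.
Implicit Types I P : set R.

Lemma right_idealN I x : is_right_ideal I -> I x -> I (- x).
Proof. by move=> hI Ix; rewrite -mulrN1; apply: right_idealM. Qed.

Lemma setT_right_ideal : is_right_ideal (setT : set R).
Proof. by split. Qed.

Lemma rcolon_right_ideal I a : is_right_ideal I -> is_right_ideal (rcolon a I).
Proof.
move=> hI; split=> [|x y Ix Iy|x r Ix]; rewrite /rcolon /=.
- by rewrite mulr0; apply: right_ideal0.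
- by rewrite mulrDr; apply: right_idealD.
- by rewrite mulrA; apply: right_idealM.
Qed.

Lemma add_principal_right_ideal I a :
  is_right_ideal I -> is_right_ideal (add_principal I a).
Proof.
move=> hI; split.
- by exists 0, 0; split; [exact: right_ideal0 | rewrite mulr0 addr0].
- move=> _ _ [i [r [Ii ->]]] [j [s [Ij ->]]]; exists (i + j), (r + s).
  by split; [exact: right_idealD | rewrite mulrDr addrACA].
- move=> _ s [i [r [Ii ->]]]; exists (i * s), (r * s).
  by split; [exact: right_idealM | rewrite mulrDl mulrA].
Qed.

Lemma sub_add_principal I a : I `<=` add_principal I a.
Proof. by move=> x Ix; exists x, 0; rewrite mulr0 addr0. Qed.

Lemma mem_add_principal I a : is_right_ideal I -> add_principal I a a.
Proof.
by move=> hI; exists 0, 1; rewrite mulr1 add0r; split=> //; exact: right_ideal0.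
Qed.

Lemma rcolon_addl_mul I i a r : is_right_ideal I -> I i ->
  rcolon (i + a * r) I = rcolon r (rcolon a I).
Proof.
move=> hI Ii; apply/seteqP; split=> s; rewrite /rcolon /= mulrDl -mulrA => Is.
  rewrite -(addKr (i * s) (a * (r * s))); apply: right_idealD => //.
  by apply: right_idealN => //; apply: right_idealM.
by apply: right_idealD => //; apply: right_idealM.
Qed.

End RightIdeals.

Section GabrielFilters.
Context {R : pzRingType} {F : set (set R)}.
Hypothesis hF : right_Gabriel_filter F.

Lemma Gabriel_filter_setT : F setT.
Proof.
have [I FI] := Gabriel_nonempty hF; have hI := Gabriel_right_ideal hF FI.
exact: (Gabriel_up hF hI (setT_right_ideal R) FI).
Qed.

Lemma Gabriel_filter_divisible : divisible F.
Proof.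
by move=> a I FI; apply: Gabriel_colon => //; apply: Gabriel_right_ideal FI.
Qed.

Lemma Gabriel_filter_Oka : right_Oka_family F.
Proof.
split=> [I FI||I a hI FIa FaI]; first exact: Gabriel_right_ideal FI.
  exact: Gabriel_filter_setT.
apply: (Gabriel_local hF (add_principal_right_ideal _ _ a hI) hI FIa).
move=> _ [i [r [Ii ->]]]; rewrite rcolon_addl_mul //.
exact: Gabriel_filter_divisible.
Qed.

End GabrielFilters.

Section MaximalOutsideFilter.
Context {R : pzRingType} {F : set (set R)} {P : set R}.
Hypothesis maxP : Max (family_compl F) P.

Lemma Max_compl_above J a : is_right_ideal J -> P `<=` J -> J a -> ~ P a -> F J.
Proof.
move: maxP => [_ maxPJ] hJ PJ Ja nPa; apply: contrapT => nFJ; apply: nPa.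
by rewrite -(maxPJ J).
Qed.

(** P + aR is strictly above P, hence in F; with a^-1 P also in F, the Oka
    condition would put P itself in F. *)
Lemma Max_compl_rcolon a : right_Oka_family F -> ~ P a -> ~ F (rcolon a P).
Proof.
move=> OkaF nPa FaP; have [[hP nFP] _] := maxP.
apply/nFP/(Oka_ext OkaF hP _ FaP).
apply: (Max_compl_above _ a) nPa; first exact: add_principal_right_ideal.
  exact: sub_add_principal.
exact: mem_add_principal.
Qed.

End MaximalOutsideFilter.

Section CyclicQuotient.
Context {R : pzRingType} {P : set R} {hP : is_right_ideal P}.

Local Notation Q := (module_quot (right_ideal_submodule hP)).
Local Notation proj := (module_proj (right_ideal_submodule hP)).

(** Module elements lift to elements typed in R, not in the carrier of the
    regular module, so that the ring operations on them are those of R and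
    not those of the converse ring. *)
Lemma module_proj_lift (q : Q) : exists a : R, q = proj a.
Proof. by have [a ->] := module_proj_surj q; exists a. Qed.

Lemma module_proj0 : proj 0 = 0.
Proof. by apply: (addrI (proj 0)); rewrite -module_projD !addr0. Qed.

Lemma module_proj_eq0 {a : R} : proj a = 0 <-> P a.
Proof. by rewrite -module_proj0 module_projP subr0. Qed.

Lemma ract_module_proj (a r : R) : ract (proj a) r = proj (a * r).
Proof. by rewrite -module_proj_ract. Qed.

Lemma module_proj_preimage_right_ideal {N : set Q} :
  is_submodule N -> is_right_ideal [set a : R | N (proj a)].
Proof.
move=> hN; split=> [|x y Nx Ny|x r Nx] /=.
- by rewrite module_proj0; apply: submodule0.
- by rewrite module_projD; apply: submoduleD.
- by rewrite -ract_module_proj; apply: submoduleZ.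
Qed.

End CyclicQuotient.

Lemma submodule_neq0 {R : pzRingType} {M : lmodType R^c} {N : set M} :
  is_submodule N -> N <> [set 0] -> exists2 x, N x & x <> 0.
Proof.
move=> hN N0; apply: contrapT => noX; apply: N0.
apply/seteqP; split=> [x Nx|x ->] /=; last exact: submodule0.
by apply: contrapT => x0; apply: noX; exists x.
Qed.

Lemma Max_compl_Gabriel_comonoform {R : pzRingType} {F : set (set R)}
    {P : set R} :
  right_Gabriel_filter F -> Max (family_compl F) P -> comonoform P.
Proof.
move=> hF maxP; have [[hP nFP] _] := maxP.
have PT : P <> setT.
  by move=> PT; apply: nFP; rewrite PT; exact: Gabriel_filter_setT.
split=> //; exists hP; split.
  exists (module_proj (right_ideal_submodule hP) 1) => /module_proj_eq0 P1.
  apply: PT; apply/seteqP; split=> // r _.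
  by rewrite -(mul1r r); apply: right_idealM.
move=> N hN N0 x y; have [a ->] := module_proj_lift x.
have [b ->] := module_proj_lift y => a0 annN.
set J := [set c : R | N (module_proj (right_ideal_submodule hP) c)].
have hJ : is_right_ideal J := module_proj_preimage_right_ideal hN.
have FJ : F J.
  have [z] := submodule_neq0 hN N0; have [c ->] := module_proj_lift z.
  move=> Jc c0; apply: (Max_compl_above maxP _ c) => //.
    move=> p Pp; rewrite /J /=.
    by rewrite module_proj_eq0.2 //; apply: submodule0.
  by move=> Pc; apply/c0/module_proj_eq0.
have nPa : ~ P a by move=> Pa; apply/a0/module_proj_eq0.
apply: (Max_compl_rcolon maxP _ (Gabriel_filter_Oka hF) nPa).
apply: (Gabriel_up hF (rcolon_right_ideal _ _ b hJ)).
- exact: rcolon_right_ideal.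
- exact: Gabriel_filter_divisible.
(* b r in J means (b + P) r in N, and such r kill a + P by annN. *)
move=> r Jbr; apply: (module_proj_eq0 (hP := hP)).1.
rewrite -ract_module_proj; change ([set 0] (ract (module_proj
  (right_ideal_submodule hP) a) r)).
by rewrite -annN; exists r => //; rewrite /colon /= ract_module_proj.
Qed.

Theorem proposition6p20 (R : pzRingType) (F : set (set R)) :
  right_Gabriel_filter F ->
  (right_Oka_family F /\ divisible F) /\
  (forall P : set R, Max (family_compl F) P -> comonoform P).
Proof.
move=> hF; split; first split.
- exact: Gabriel_filter_Oka.
- exact: Gabriel_filter_divisible.
- by move=> P; apply: Max_compl_Gabriel_comonoform.
Qed.
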